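(* Let $G$ be a connected multigraph (multiple edges allowed, no loops) with maximum degree $\Delta(G)$, and let $k$ be a non-negative integer such that $\Delta(L(G))\le\Delta(G)+k$, where $L(G)$ is the line graph of $G$. Let the palette be $\mathcal{K}=\{1,\dots,\Delta(G)+k\}$. Let $S\subseteq E(G)$ carry a proper edge-colouring with colours from $\mathcal{K}$ such that every vertex of $G$ is incident with at most $k$ edges of $S$. Suppose that neither of the following holds: (a) $k=0$ and $G$ is a simple odd cycle; (b) $G$ has exactly three vertices, every pair of them is joined by at least one edge, the three pairs have edge multiplicities $m_1,m_2,m_3$, and $k=\min\{m_1,m_2,m_3\}-1$. Then the precolouring of $S$ can be extended to a proper edge-colouring of all of $G$ using only colours from $\mathcal{K}$.
   Context: The line graph $L(G)$ of a multigraph has the edges of $G$ as vertices, two being adjacent iff they share an end-vertex (parallel edges are adjacent). A proper edge-colouring assigns colours to edges so that any two edges sharing an end-vertex receive distinct colours. Extending a precolouring means producing a proper edge-colouring of all of $G$ agreeing with the given colours on $S$. *)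

(* Defs.v *)
From mathcomp Require Import all_boot.

Set Implicit Arguments.
Unset Strict Implicit.
Unset Printing Implicit Defensive.

(* Finite loopless multigraph: distinct edges may have the same pair of ends. *)
Record multigraph (V E : finType) := Multigraph {
  ends : E -> {set V};
  card_ends : forall e, #|ends e| = 2
}.

Definition max_degree_rel (T : finType) (r : rel T) : nat :=
  \max_(x : T) #|[set y | r x y]|.

Section Multigraph.
Variables (V E : finType) (G : multigraph V E).
Implicit Types (u v : V) (e f : E) (S : {set E}).

Definition incident v : {set E} := [set e | v \in ends G e].

(* Parallel edges are counted with multiplicity. *)
Definition degree v : nat := #|incident v|.

Definition max_degree : nat := \max_(v : V) degree v.

Definition multiplicity u v : nat := #|[set e | ends G e == [set u; v]]|.

Definition adjacent : rel V := [rel u v | 0 < multiplicity u v].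

Definition connected : Prop :=
  0 < #|V| /\ (forall u v, connect adjacent u v).

Definition line_graph : rel E :=
  [rel e f | (e != f) && [exists v, (v \in ends G e) && (v \in ends G f)]].

(* [ordS] is the cyclic successor on ['I_n]; since [2 < n] and [vtx] is
   injective, there are no parallel edges. *)
Definition simple_odd_cycle : Prop :=
  exists n : nat, [/\ odd n, 2 < n &
    exists (vtx : 'I_n -> V) (edg : 'I_n -> E),
      [/\ bijective vtx, bijective edg &
          forall i, ends G (edg i) = [set vtx i; vtx (ordS i)]]].

Definition fat_triangle (m1 m2 m3 : nat) : Prop :=
  exists x y z : V,
    [/\ uniq [:: x; y; z], [set: V] = [set x; y; z],
        [/\ multiplicity x y = m1, multiplicity y z = m2 &
            multiplicity x z = m3] &
        [/\ 0 < m1, 0 < m2 & 0 < m3]].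

(* Only the values of [c] on [S] are constrained, so that a colouring of [S]
   is represented by a function on [E] whose values outside [S] are junk. *)
Definition proper_edge_colouring (K : pred nat) S (c : E -> nat) : Prop :=
  {in S, forall e, K (c e)} /\
  {in S &, forall e f, line_graph e f -> c e <> c f}.

Definition extends S (c c' : E -> nat) : Prop := {in S, forall e, c' e = c e}.

End Multigraph.

Definition palette (n : nat) : pred nat := [pred i | 1 <= i <= n].

(* Main.v *)
Require Import Defs.
From mathcomp Require Import all_boot zify.
From Stdlib Require Import Classical.

(* If the precolouring does not extend, take a minimal set D of edges containing
   S to which it does not extend, and let W = D \ S. By minimality D can be
   coloured except for a hole at any prescribed h in W. Since h has at most
   Delta + k neighbours in L(G), it sees every colour exactly once, so h can take
   the colour of a neighbour g in W, which moves the hole to g; every edge of W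
   is thus tight. Counting degrees shows that every end of an edge of W has two
   distinct W-neighbours, so W contains a cycle C. Moving the hole around C
   yields the structure of G. If C is a triangle, an edge leaving it would have
   a colour that the hole on the opposite side cannot see, so G is a fat
   triangle and k is determined by tightness. If C is longer, no further edge of
   W meets C, so its edges have multiplicity one by the degree count; then a
   colour occurring on an edge off C appears at every second vertex of C, and a
   colour next to the hole on every second edge of C. The latter forces C to be
   odd, and then the former leaves no edge off C, so G = C and k = 0. *)

Set Implicit Arguments.
Unset Strict Implicit.
Unset Printing Implicit Defensive.

(** * Line graphs *)

Section LineGraph.
Variables (V E : finType) (G : multigraph V E).
Implicit Types (u v w : V) (e f g : E).

Lemma line_graphI u e f :
  u \in ends G e -> u \in ends G f -> e <> f -> line_graph G e f.
Proof.
move=> ue uf nef; rewrite /line_graph /=; apply/andP; split; first exact/eqP.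
by apply/existsP; exists u; rewrite ue uf.
Qed.

Lemma line_graphP e f :
  line_graph G e f -> e <> f /\ exists2 u, u \in ends G e & u \in ends G f.
Proof. by case/andP=> /eqP ? /existsP[u /andP[]]; split=> //; exists u. Qed.

Lemma line_graph_sym e f : line_graph G e f -> line_graph G f e.
Proof. by case/line_graphP=> nef [u ue uf]; apply: line_graphI uf ue _ => /esym. Qed.

Lemma ends_pair u e : u \in ends G e -> exists2 w, u <> w & ends G e = [set u; w].
Proof.
move=> ue; have /eqP/cards2P[x [y [nxy Ee]]] := card_ends G e.
move: ue; rewrite Ee !inE => /orP[]/eqP->.
  by exists y => //; apply/eqP.
by exists x; rewrite 1?setUC //; apply/eqP; rewrite eq_sym.
Qed.

Lemma ends_eq_pair u w e :
  u <> w -> u \in ends G e -> w \in ends G e -> ends G e = [set u; w].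
Proof.
move=> nuw /ends_pair[x nux ->]; rewrite !inE => /orP[]/eqP => [|->//].
by move/esym.
Qed.

(** Inclusion-exclusion on the edges at [u] and at [w]: both ends are shared exactly by the parallel
    class of [e], and the union is [e] together with its neighbours. *)
Lemma card_line_neighbours u w e : u <> w -> ends G e = [set u; w] ->
  #|[set f | line_graph G e f]| + multiplicity G u w + 1
    = degree G u + degree G w.
Proof.
move=> nuw Ee; rewrite /degree -cardsUI.
have -> : incident G u :&: incident G w = [set f | ends G f == [set u; w]].
  apply/setP=> f; rewrite !inE; apply/andP/eqP => [[]|->]; last by rewrite !inE !eqxx orbT.
  exact: ends_eq_pair.
suff -> : incident G u :|: incident G w = e |: [set f | line_graph G e f].
  by rewrite cardsU1 inE /line_graph /= eqxx /multiplicity /=; lia.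
apply/setP=> f; rewrite in_setU1 !inE.
apply/idP/idP.
  have [//|/eqP nfe] := eqVneq f e.
  by case/orP=> uf; apply: line_graphI uf _; rewrite ?Ee ?inE ?eqxx ?orbT // => /esym.
case/orP=> [/eqP->|/line_graphP[_ [x]]]; first by rewrite Ee !inE eqxx.
by rewrite Ee !inE => /orP[]/eqP-> ->; rewrite ?orbT.
Qed.

End LineGraph.

(** * Holes in a critical set *)

Section Critical.
Variables (V E : finType) (G : multigraph V E) (K : nat).
Variables (S D : {set E}) (c0 : E -> nat).

Definition extendable (X : {set E}) : Prop :=
  exists c, proper_edge_colouring G (palette K) X c /\ extends S c0 c.

Hypothesis deg_line : forall e, #|[set f | line_graph G e f]| <= K.
Hypothesis sSD : S \subset D.
Hypothesis D_not_extendable : ~ extendable D.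
Hypothesis D_critical : forall e, e \in D :\: S -> extendable (D :\ e).

Notation W := (D :\: S).

(** The value of [c] at [h] is junk. *)
Definition hole (h : E) (c : E -> nat) : Prop :=
  [/\ h \in W, proper_edge_colouring G (palette K) (D :\ h) c & extends S c0 c].

Lemma ex_hole h : h \in W -> exists c, hole h c.
Proof. by move=> hW; have [c []] := D_critical hW; exists c. Qed.

(** If colour [i] were missing around [h], giving it to [h] would extend the precolouring to [D]. *)
Lemma hole_sees h c i : hole h c -> palette K i ->
  exists g, [/\ line_graph G h g, g \in D & c g = i].
Proof.
case=> hW [cK cP] cS iK; apply: NNPP => no; apply: D_not_extendable.
have /setDP[hD hS] := hW.
exists (fun e => if e == h then i else c e); split; last first.
  by move=> e eS; case: eqP => [eh|_]; [rewrite -eh eS in hS | exact: cS].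
split=> [e eD|e f eD fD].
  by case: eqP => // /eqP eh; apply: cK; rewrite !inE eh.
case: eqP => [->|/eqP eh]; case: eqP => [->|/eqP fh] ef.
- by case: (line_graphP ef).
- by move=> ic; apply: no; exists f; split.
- by move=> ic; apply: no; exists e; split=> //; apply: line_graph_sym.
- by apply: cP => //; rewrite !inE ?eh ?fh.
Qed.

(** Pigeonhole: all [K] colours occur on the neighbours of [h] in [D], and [h] has at most [K]
    neighbours altogether, so [c] is a bijection from the neighbours to the palette. *)
Lemma hole_tight h c : hole h c ->
  [/\ #|[set f | line_graph G h f]| = K,
      forall g, line_graph G h g -> g \in D &
      forall f g, line_graph G h f -> line_graph G h g -> c f = c g -> f = g].
Proof.
move=> hc; set N := [set f | line_graph G h f].
have sub : {subset iota 1 K <= [seq c e | e <- enum (N :&: D)]}.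
  move=> i; rewrite mem_iota => iK.
  have [|g [hg gD <-]] := @hole_sees h c i hc; first by rewrite /palette /=; lia.
  by apply: map_f; rewrite mem_enum !inE gD andbT; exact: hg.
have := uniq_leq_size (iota_uniq 1 K) sub.
rewrite size_iota size_map -cardE => leK.
have le2 : #|N :&: D| <= #|N| by apply/subset_leq_card/subsetIl.
have leN : #|N| <= K := deg_line h.
have ND : N :&: D = N.
  by apply/eqP; rewrite eqEcard subsetIl; lia.
have /dinjectiveP inj : dinjectiveb c (mem (N :&: D)).
  rewrite /dinjectiveb; apply: (leq_size_uniq (iota_uniq 1 K) sub).
  by rewrite size_map -cardE size_iota; lia.
split; first by lia.
  move=> g hg; have : g \in N by rewrite inE.
  by rewrite -ND inE => /andP[].
by move=> f g hf hg; apply: inj; rewrite ND inE.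
Qed.

Lemma critical_card h : h \in W -> #|[set f | line_graph G h f]| = K.
Proof. by case/ex_hole=> c /hole_tight[]. Qed.

Lemma critical_dom h g : h \in W -> line_graph G h g -> g \in D.
Proof. by case/ex_hole=> c /hole_tight[_ + _]; apply. Qed.

Lemma hole_inj h c f g : hole h c ->
  line_graph G h f -> line_graph G h g -> c f = c g -> f = g.
Proof. by move=> /hole_tight[_ _]; apply. Qed.

Lemma hole_palette h c g : hole h c -> g \in D -> g <> h -> palette K (c g).
Proof. by case=> _ [cK _] _ gD /eqP gh; apply: cK; rewrite !inE gh. Qed.

Lemma hole_proper h c f g : hole h c -> f \in D -> f <> h -> g \in D -> g <> h ->
  line_graph G f g -> c f <> c g.
Proof.
by case=> _ [_ cP] _ fD /eqP fh gD /eqP gh; apply: cP; rewrite !inE ?fh ?gh.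
Qed.

Definition move_hole (h g : E) (c : E -> nat) : E -> nat :=
  fun e => if e == h then c g else c e.

Lemma move_holeE h g c : move_hole h g c h = c g.
Proof. by rewrite /move_hole eqxx. Qed.

Lemma move_hole_neq h g c e : e <> h -> move_hole h g c e = c e.
Proof. by rewrite /move_hole => /eqP/negPf->. Qed.

(** Since [h] sees each colour only once, [g] is the only obstacle to giving [h] the colour [c g],
    and [g] becomes the hole. *)
Lemma move_holeP h g c : hole h c -> g \in W -> line_graph G h g ->
  hole g (move_hole h g c).
Proof.
move=> hc gW hg; have [hW [cK cP] cS] := hc.
have /setDP[hD hS] := hW; have [ngh _] := line_graphP hg.
have /setDP[gD gS] := gW.
split=> //; last first.
  move=> e eS; rewrite move_hole_neq ?cS // => eh.
  by rewrite -eh eS in hS.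
split=> [e|e f].
  rewrite !inE => /andP[eg eD].
  have [->|/eqP eh] := eqVneq e h.
    by rewrite move_holeE; apply: (hole_palette hc) => // /esym.
  by rewrite move_hole_neq //; apply: (hole_palette hc).
rewrite !inE => /andP[/eqP eg eD] /andP[/eqP fg fD] ef.
have [eh|/eqP eh] := eqVneq e h; have [fh|/eqP fh] := eqVneq f h; subst.
- by case: (line_graphP ef).
- rewrite move_holeE move_hole_neq // => /(hole_inj hc hg ef) gf.
  by rewrite gf in fg.
- rewrite move_holeE move_hole_neq // => /(hole_inj hc (line_graph_sym ef) hg) gf.
  by rewrite gf in eg.
- by rewrite !move_hole_neq //; apply: (hole_proper hc).
Qed.

(** The hole walks along [a], and each edge left behind takes the colour of the next one.
    Distinctness ensures that this colour is still the original one. *)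
Lemma shift_hole (a : nat -> E) m c :
  hole (a 0) c -> (forall i, i <= m -> a i \in W) ->
  (forall i, i < m -> line_graph G (a i) (a i.+1)) ->
  (forall i j, i < j -> j <= m -> a i <> a j) ->
  exists c', [/\ hole (a m) c', forall i, i < m -> c' (a i) = c (a i.+1) &
                 forall g, (forall i, i < m -> g <> a i) -> c' g = c g].
Proof.
move=> hc; elim: m => [|m IHm] aW adj inj; first by exists c; split.
have [|||c' [hc' ca cg]] := IHm.
- by move=> i ?; apply: aW; lia.
- by move=> i ?; apply: adj; lia.
- by move=> i j ? ?; apply: inj; lia.
exists (move_hole (a m) (a m.+1) c'); split.
- by apply: move_holeP => //; [exact: aW | exact: adj].
- move=> i; rewrite ltnS leq_eqVlt => /orP[/eqP->|im].
    rewrite move_holeE cg // => i' i'm; apply/nesym; apply: inj; lia.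
  by rewrite move_hole_neq ?ca //; apply: inj.
- move=> g ga; rewrite move_hole_neq; last exact: ga.
  by apply: cg => i im; apply: ga; lia.
Qed.

(* Moving the hole once around the cycle rotates the colours of [a 1 .. a m],
   and the only colour seen by [f] which changes is that of [a m]. *)
Lemma no_pendant_on_line_cycle (a : nat -> E) m f :
  1 < m -> (forall i, i <= m -> a i \in W) ->
  (forall i, i < m -> line_graph G (a i) (a i.+1)) ->
  (forall i j, i < j -> j <= m -> a i <> a j) ->
  line_graph G (a m) (a 0) ->
  f \in W -> (forall i, i <= m -> f <> a i) ->
  line_graph G f (a 0) -> line_graph G f (a m) ->
  (forall i, 0 < i < m -> ~ line_graph G f (a i)) -> False.
Proof.
move=> m1 aW adj inj adjm fW fa f0 fm fi.
have [c hc] := ex_hole (aW 0 isT).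
have [c' [hc' ca cg]] := shift_hole hc aW adj inj.
have hc'' := move_holeP hc' (aW 0 isT) adjm.
have hc1 := move_holeP hc fW (line_graph_sym f0).
have hc2 := move_holeP hc'' fW (line_graph_sym f0).
set c'' := move_hole _ _ c' in hc'' hc2.
set c1 := move_hole _ _ c in hc1.
set c2 := move_hole _ _ c'' in hc2.
have n0m : a 0 <> a m by apply: inj; lia.
have c1m : c1 (a m) = c (a m) by rewrite /c1 move_hole_neq //; exact/nesym.
have c2m : c2 (a m) = c (a 1).
  by rewrite /c2 move_hole_neq /c'' ?move_holeE ?ca //; [lia | exact/nesym].
have n1m : c (a 1) <> c (a m).
  move=> /(hole_inj hc (adj 0 (ltnW m1)) (line_graph_sym adjm)).
  by apply: inj.
have cc t : line_graph G f t -> t <> a m -> c2 t = c1 t.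
  move=> ft tm; rewrite /c1 /c2.
  have [->|/eqP t0] := eqVneq t (a 0).
    rewrite !move_holeE /c'' move_hole_neq; last exact: fa.
    by apply: cg => i im; apply: fa; lia.
  rewrite !move_hole_neq // /c'' move_hole_neq //; apply: cg => -[//|i] im ti.
  by apply: (fi i.+1); [lia | rewrite -ti].
(* With the hole at [f], [c1] is reached directly and [c2] after the rotation. Under [c2] the edge
   [a m] has lost its colour, so [f] must see that colour on some other [t]; but [t] has it under
   [c1] as well, where [a m] still carries it. *)
have [|t [ft tD ct]] := hole_sees hc2 (i := c (a m)).
  apply: (hole_palette hc); last exact/nesym.
  by have /setDP[] := aW m (leqnn m).
have tm : t <> a m by move=> tm; apply: n1m; rewrite -c2m -ct tm.
by apply: (tm); apply: (hole_inj hc1 ft fm); rewrite c1m -ct cc.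
Qed.

(** With the hole at [f], the colour of [s] is seen on some [t] at [y] or [z]. Moving the hole to
    the side joining that vertex to [x] makes it see both [s] and [t], of the same colour. *)
Lemma triangle_no_exit x y z e f g s :
  e \in W -> f \in W -> g \in W ->
  ends G e = [set x; y] -> ends G f = [set y; z] -> ends G g = [set x; z] ->
  x \in ends G s -> y \notin ends G s -> z \notin ends G s -> False.
Proof.
move=> eW fW gW Ee Ef Eg xs ys zs.
have [c hc] := ex_hole fW.
have inP u w h : ends G h = [set u; w] -> u \in ends G h /\ w \in ends G h.
  by move=> ->; rewrite !inE !eqxx orbT.
have [[[xe ye] [yf zf]] [xg zg]] := (inP _ _ _ Ee, inP _ _ _ Ef, inP _ _ _ Eg).
have nse : s <> e by move=> se; rewrite se ye in ys.
have nsf : s <> f by move=> sf; rewrite sf yf in ys.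
have nsg : s <> g by move=> sg; rewrite sg zg in zs.
have sD : s \in D by apply: (critical_dom eW); apply: line_graphI xe xs _ => /esym.
have xf : x \notin ends G f.
  rewrite Ef !inE; have := card_ends G e; have := card_ends G g; rewrite Ee Eg !cards2.
  by case: eqP => // nxz; case: eqP.
have nef : e <> f by move=> ef; rewrite -ef xe in xf.
have ngf : g <> f by move=> gf; rewrite -gf xg in xf.
have [|t [ft tD ct]] := hole_sees hc (i := c s).
  exact: (hole_palette hc).
have nts : t <> s.
  move=> ts; have [_ [u]] := line_graphP ft.
  by rewrite ts Ef !inE => /orP[]/eqP-> us; [rewrite us in ys|rewrite us in zs].
(* Here [w] is the end of [f] at which [t] attaches, and [h] is the side joining [x] to [w]. *)
have key w h : h \in W -> x \in ends G h -> w \in ends G h -> w \in ends G f ->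
    w \in ends G t -> s <> h -> h <> f -> False.
  move=> hW xh wh wf wt nsh nhf.
  have hD : h \in D by have /setDP[] := hW.
  have hs : line_graph G h s by apply: line_graphI xh xs _ => /esym.
  have nth : t <> h.
    by move=> th; apply: (hole_proper hc hD nhf sD nsf hs); rewrite -ct th.
  have [nft _] := line_graphP ft.
  have hc1 := move_holeP hc hW (line_graphI wf wh (nesym nhf)).
  apply: nts; apply: (hole_inj hc1 _ hs).
    by apply: line_graphI wh wt _ => /esym.
  by rewrite !move_hole_neq // => /esym.
have [_ [u]] := line_graphP ft.
rewrite Ef !inE => /orP[]/eqP-> ut.
  exact: (key y e).
exact: (key z g).
Qed.

(** * Cycles of critical edges *)

(** Indices modulo [n] are encoded by periodic sequences on [nat], so that the cycle can be
    restarted anywhere by a plain shift. *)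
Definition critical_cycle (n : nat) (v : nat -> V) (e : nat -> E) : Prop :=
  [/\ 2 < n, forall i, v (i + n) = v i, forall i, e (i + n) = e i,
      forall i j, i < j -> j < i + n -> v i <> v j &
      forall i, e i \in W /\ ends G (e i) = [set v i; v i.+1]].

Lemma cycle_shift j n v e : critical_cycle n v e ->
  critical_cycle n (fun i => v (j + i)) (fun i => e (j + i)).
Proof.
case=> n2 vn en vI eW; split=> //.
- by move=> i; rewrite addnA vn.
- by move=> i; rewrite addnA en.
- by move=> i i' ? ?; apply: vI; lia.
- by move=> i; rewrite addnS.
Qed.

Lemma cycle_add_mul n v e i q : critical_cycle n v e ->
  v (i + q * n) = v i /\ e (i + q * n) = e i.
Proof.
case=> _ vn en _ _; elim: q => [|q [IHv IHe]]; first by rewrite addn0.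
by rewrite mulSn [n + _]addnC addnA vn en.
Qed.

(** Any index can be moved into a chosen period, where the distinctness conditions apply. *)
Lemma cycle_window n v e m i : critical_cycle n v e ->
  exists j, [/\ m <= j, j < m + n, v j = v i & e j = e i].
Proof.
move=> C; have [n2 _ _ _ _] := C.
have le : m <= i + m * n by nia.
exists (m + (i + m * n - m) %% n).
have [vq eq] := cycle_add_mul (m + (i + m * n - m) %% n) ((i + m * n - m) %/ n) C.
have Ej : m + (i + m * n - m) %% n + (i + m * n - m) %/ n * n = i + m * n.
  by have := divn_eq (i + m * n - m) n; lia.
rewrite Ej in vq eq; have [vi ei] := cycle_add_mul i m C.
have := ltn_pmod (i + m * n - m) (ltnW (ltnW n2)).
by rewrite -vq -eq vi ei; split=> //; lia.
Qed.

Lemma cycle_meml n v e i : critical_cycle n v e -> v i \in ends G (e i).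
Proof. by case=> _ _ _ _ /(_ i)[_ ->]; rewrite !inE eqxx. Qed.

Lemma cycle_memr n v e i : critical_cycle n v e -> v i.+1 \in ends G (e i).
Proof. by case=> _ _ _ _ /(_ i)[_ ->]; rewrite !inE eqxx orbT. Qed.

Lemma cycle_mem n v e i j : critical_cycle n v e ->
  i <= j -> j < i + n -> v i.+1 \in ends G (e j) -> j = i \/ j = i.+1.
Proof.
case=> n2 _ _ vI /(_ j)[_ ->] ij jn; rewrite !inE => /orP[]/eqP vij.
  have [->|nji] := eqVneq j i; first by left.
  have [->|nji1] := eqVneq j i.+1; first by right.
  by case: (vI i.+1 j) => //; lia.
have [->|nji] := eqVneq j i; first by left.
by case: (vI i.+1 j.+1) => //; lia.
Qed.

Lemma cycle_edge_neq n v e i j : critical_cycle n v e ->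
  i < j -> j < i + n -> e i <> e j.
Proof.
move=> C ij jn eij; have [n2 _ _ vI _] := C.
have := cycle_meml i C; have := cycle_memr i C; rewrite eij.
case/(cycle_mem C); [lia | lia | lia | move=> ->].
have [_ _ _ _ /(_ i.+1)[_ ->]] := C.
by rewrite !inE => /orP[]/eqP; apply: vI; lia.
Qed.

Lemma cycle_adj n v e i : critical_cycle n v e -> line_graph G (e i) (e i.+1).
Proof.
move=> C; apply: line_graphI (cycle_memr i C) (cycle_meml i.+1 C) _.
by apply: (cycle_edge_neq C) => //; case: C => ?; lia.
Qed.

Lemma cycle_edgeW n v e i : critical_cycle n v e -> e i \in W.
Proof. by case=> _ _ _ _ /(_ i)[]. Qed.

Lemma cycle_ends n v e i : critical_cycle n v e -> ends G (e i) = [set v i; v i.+1].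
Proof. by case=> _ _ _ _ /(_ i)[]. Qed.

Lemma cycle_close n v e : critical_cycle n v e ->
  [/\ v n = v 0, e n = e 0, ends G (e n.-1) = [set v n.-1; v 0] &
      line_graph G (e n.-1) (e 0)].
Proof.
move=> C; have [n2 vn en _ _] := C; have := vn 0; have := en 0; rewrite !add0n => en0 vn0.
have Sn : n.-1.+1 = n by lia.
split=> //; first by rewrite (cycle_ends _ C) Sn vn0.
by rewrite -en0 -{2}Sn; apply: cycle_adj C.
Qed.

Lemma cycle_not_adj n v e i j : critical_cycle n v e ->
  i.+1 < j -> j.+1 < i + n -> ~ line_graph G (e i) (e j).
Proof.
move=> C ij jn /line_graphP[_ [u]]; have [_ _ _ vI _] := C.
rewrite !(cycle_ends _ C) !inE => /orP[]/eqP-> /orP[]/eqP; apply: vI; lia.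
Qed.

(** As [w] is off the cycle, [f] meets only the two cycle edges at [v 0], so
    [no_pendant_on_line_cycle] applies to the cycle itself. *)
Lemma cycle_no_pendant n v e f w : critical_cycle n v e -> f \in W ->
  ends G f = [set v 0; w] -> (forall i, w <> v i) -> False.
Proof.
move=> C fW Ef nw; have [n2 _ _ vI _] := C; have [vn en Ee adj] := cycle_close C.
have nf i : f <> e i.
  by move=> fe; have := cycle_ends i C; rewrite -fe Ef => /setP/(_ w);
     rewrite !inE eqxx orbT => /esym/orP[]/eqP; apply: nw.
have v0f : v 0 \in ends G f by rewrite Ef !inE eqxx.
apply: (@no_pendant_on_line_cycle e n.-1 f) => //.
- lia.
- by move=> i _; apply: cycle_edgeW C.
- by move=> i _; apply: cycle_adj C.
- by move=> i j ij jn; apply: (cycle_edge_neq C); lia.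
- exact: line_graphI v0f (cycle_meml 0 C) (nf 0).
- by apply: line_graphI v0f _ (nf _); rewrite Ee !inE eqxx orbT.
- move=> i lti /line_graphP[_ [u]].
  rewrite Ef (cycle_ends i C) !inE => /orP[]/eqP-> /orP[]/eqP; try exact: nw.
    by apply: vI; lia.
  by apply: vI; lia.
Qed.

(** The chord closes [e 0], ..., [e j.-1] to a shorter cycle, and [e n.-1] is then a pendant edge on
    it at [v 0]. *)
Lemma cycle_no_chord n v e f j : critical_cycle n v e -> f \in W ->
  1 < j -> j.+1 < n -> ends G f = [set v 0; v j] -> False.
Proof.
move=> C fW j1 jn Ef; have [n2 _ _ vI _] := C; have [vn en Ee adj] := cycle_close C.
have v0f : v 0 \in ends G f by rewrite Ef !inE eqxx.
have vjf : v j \in ends G f by rewrite Ef !inE eqxx orbT.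
have v0e : v 0 \in ends G (e n.-1) by rewrite Ee !inE eqxx orbT.
have nf i : i < j -> e i <> f.
  move=> ij ef; have := vjf; rewrite -ef (cycle_ends i C) !inE => /orP[]/eqP vv.
    by case: (vI i j) => //; lia.
  have [jS|ne] := eqVneq j i.+1; last by case: (vI i.+1 j) => //; lia.
  by have := v0f; rewrite -ef (cycle_ends i C) !inE => /orP[]/eqP; apply: vI; lia.
have nf' : e n.-1 <> f.
  move=> ef; have := vjf; rewrite -ef Ee !inE => /orP[]/eqP vv.
    by case: (vI j n.-1) => //; lia.
  by case: (vI 0 j) => //; lia.
pose a i := if i < j then e i else f.
have ae i : i < j -> a i = e i by rewrite /a => ->.
have aj : a j = f by rewrite /a ltnn.
apply: (@no_pendant_on_line_cycle a j (e n.-1)) => //.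
- by move=> i _; rewrite /a; case: ifP => // _; apply: cycle_edgeW C.
- move=> i ij; rewrite ae //; have [lt|nlt] := boolP (i.+1 < j).
    by rewrite ae //; apply: cycle_adj C.
  have <- : j = i.+1 by lia.
  rewrite aj; apply: (line_graphI _ vjf); last exact: nf.
  by have -> : j = i.+1; [lia | apply: cycle_memr C].
- move=> i i' ii' i'j; rewrite ae; last by lia.
  have [->|ne] := eqVneq i' j; first by rewrite aj; apply: nf; lia.
  by rewrite ae; [apply: (cycle_edge_neq C) | ]; lia.
- rewrite aj ae; last by lia.
  by apply: line_graphI v0f (cycle_meml 0 C) _; apply/nesym/nf; lia.
- exact: cycle_edgeW C.
- move=> i ij; have [->|ne] := eqVneq i j; first by rewrite aj.
  by rewrite ae; [apply/nesym/(cycle_edge_neq C) | ]; lia.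
- by rewrite ae //; lia.
- by rewrite aj; apply: line_graphI v0e v0f nf'.
- move=> i ij; rewrite ae; last by lia.
  by move/line_graph_sym; apply: (cycle_not_adj C); lia.
Qed.

(** The edges [e 0], [e n.-1], [f] all meet at [v 0] and form a triangle in the line graph. The edge
    [e 1] is adjacent to [e 0] and [f] but, as [3 < n], not to [e n.-1]. *)
Lemma cycle_no_parallel n v e f : critical_cycle n v e -> 3 < n -> f \in W ->
  ends G f = ends G (e 0) -> f = e 0.
Proof.
move=> C n3 fW Ef; apply: NNPP => nf.
have [_ _ _ vI _] := C; have [vn en Ee adj] := cycle_close C.
have v0f : v 0 \in ends G f by rewrite Ef; apply: cycle_meml C.
have v1f : v 1 \in ends G f by rewrite Ef; apply: cycle_memr C.
have v0e : v 0 \in ends G (e n.-1) by rewrite Ee !inE eqxx orbT.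
have v0e1 : v 0 \notin ends G (e 1).
  rewrite (cycle_ends 1 C) !inE; apply/negP => /orP[]/eqP; apply: vI; lia.
have v1en : v 1 \notin ends G (e n.-1).
  by rewrite Ee !inE; apply/negP => /orP[/eqP|/eqP/esym]; apply: vI; lia.
have nf1 : e 1 <> f by move=> ef; rewrite ef v0f in v0e1.
have nfn : e n.-1 <> f by move=> ef; rewrite ef v1f in v1en.
have n0n : e 0 <> e n.-1 by apply: (cycle_edge_neq C); lia.
have n01 : e 0 <> e 1 by apply: (cycle_edge_neq C); lia.
have n1n : e 1 <> e n.-1 by apply: (cycle_edge_neq C); lia.
pose a i := if i == 0 then e 0 else if i == 1 then e n.-1 else f.
apply: (@no_pendant_on_line_cycle a 2 (e 1)) => //.
- by rewrite /a => -[|[|i]] _ //=; apply: cycle_edgeW C.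
- rewrite /a => -[|[|i]] //= _; first exact: line_graph_sym.
  exact: line_graphI v0e v0f nfn.
- by rewrite /a => -[|[|i]] [|[|[|j]]] //= _ _ /esym.
- by rewrite /a /=; apply: line_graphI v0f (cycle_meml 0 C) nf.
- exact: cycle_edgeW C.
- by rewrite /a => -[|[|i]] //= _ /esym.
- by apply/line_graph_sym/(cycle_adj 0 C).
- exact: line_graphI (cycle_meml 1 C) v1f nf1.
- by rewrite /a => -[|[|i]] //= _; apply: (cycle_not_adj C); lia.
Qed.

Lemma cycle_critical_edges n v e f : critical_cycle n v e -> 3 < n -> f \in W ->
  v 0 \in ends G f -> f = e 0 \/ f = e n.-1.
Proof.
move=> C n3 fW /ends_pair[w nw Ef]; have [vn en Ee adj] := cycle_close C.
have [[i wi]|off] := classic (exists i, w = v i); last first.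
  by case: (cycle_no_pendant C fW Ef) => i wi; apply: off; exists i.
have [j [_ jn vj _]] := cycle_window 0 i C; rewrite -{}vj in wi; subst w.
have [j0|j0] := eqVneq j 0; first by subst j.
have [j1|j1] := eqVneq j 1.
  by left; apply: (cycle_no_parallel C) => //; rewrite Ef j1 (cycle_ends 0 C).
have [jn1|jn1] := eqVneq j n.-1; last by case: (cycle_no_chord C fW _ _ Ef); lia.
(* The shift by [n.-1] makes [e n.-1] the first edge of the cycle. *)
right; have := cycle_no_parallel (cycle_shift n.-1 C) n3 fW.
by rewrite addn0; apply; rewrite Ef Ee jn1 setUC.
Qed.

Lemma cycle_neighbour n v e i j : critical_cycle n v e ->
  line_graph G (e i.+1) (e j) -> e j = e i \/ e j = e i.+2.
Proof.
move=> C; have [j' [ij' j'n _ <-]] := cycle_window i j C; move: j' ij' j'n => {}j ij jn.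
case/line_graphP=> nij [u]; rewrite (cycle_ends _ C) !inE => /orP[]/eqP-> uj.
  by case: (cycle_mem C ij jn uj) => jE; [left | case: nij]; rewrite jE.
have [->|ji] := eqVneq j i; first by left.
case: (cycle_mem C _ _ uj) => [||jE|->]; [lia | lia | | by right].
by case: nij; rewrite jE.
Qed.

Lemma cycle_shift_hole n v e m c : critical_cycle n v e -> hole (e 0) c -> m < n ->
  exists c', [/\ hole (e m) c', forall i, i < m -> c' (e i) = c (e i.+1) &
                 forall g, (forall i, i < m -> g <> e i) -> c' g = c g].
Proof.
move=> C hc mn; apply: shift_hole => // [i _|i _|i j ij jm].
- exact: cycle_edgeW C.
- exact: cycle_adj C.
- by apply: (cycle_edge_neq C); lia.
Qed.

(** * Colours on edges off a cycle *)

Definition off_cycle (e : nat -> E) (s : E) : Prop := forall i, s <> e i.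

Lemma not_off_cycle e s : ~ off_cycle e s -> exists i, s = e i.
Proof. by move=> no; apply: NNPP => ne; apply: no => i si; apply: ne; exists i. Qed.

Lemma cycle_hole_at n v e i c : critical_cycle n v e -> hole (e 0) c ->
  exists2 c', hole (e i) c' & forall s, off_cycle e s -> c' s = c s.
Proof.
move=> C hc; elim: i => [|i [c' hc' cE]]; first by exists c.
exists (move_hole (e i) (e i.+1) c').
  by apply: move_holeP => //; [apply: cycle_edgeW C | apply: cycle_adj C].
by move=> s so; rewrite move_hole_neq ?cE.
Qed.

Definition off_colour (v : nat -> V) (e : nat -> E) (c : E -> nat) (x i : nat) :=
  exists s, [/\ off_cycle e s, v i \in ends G s & c s = x].

Section NoParallel.
Variables (n : nat) (v : nat -> V) (e : nat -> E).
Hypothesis C : critical_cycle n v e.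
Hypothesis simple : forall i g, ends G g = ends G (e i) -> g = e i.

Lemma off_adjl i s : off_cycle e s -> v i \in ends G s -> line_graph G (e i) s.
Proof. by move=> so vs; apply: line_graphI (cycle_meml i C) vs _; apply/nesym. Qed.

Lemma off_adjr i s : off_cycle e s -> v i.+1 \in ends G s -> line_graph G (e i) s.
Proof. by move=> so vs; apply: line_graphI (cycle_memr i C) vs _; apply/nesym. Qed.

(** The hole [e i] would see [x] at both its ends, hence on a single edge, which would be parallel
    to [e i]. *)
Lemma off_colour_gap c x i : hole (e i) c ->
  off_colour v e c x i -> ~ off_colour v e c x i.+1.
Proof.
move=> hc [s [so vs <-]] [t [to vt]].
move/(hole_inj hc (off_adjr to vt) (off_adjl so vs)) => ts; subst t.
have [n2 _ _ vI _] := C.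
apply: (so i); apply: simple; rewrite (cycle_ends _ C); apply: ends_eq_pair => //.
by apply: vI; lia.
Qed.

(** Once the hole is at [e 1], it must see [x]. At [v 1] off the cycle this is excluded by the gap,
    on [e 0] by the adjacent [s], and on [e 2] by one more turn; only an off-cycle edge at [v 2]
    remains. *)
Lemma off_colour_step c x : hole (e 0) c ->
  off_colour v e c x 0 -> off_colour v e c x 2.
Proof.
move=> hc O0; have gap := off_colour_gap hc O0; case: O0 => s [so vs csx].
have [c1 hc1 c1E] := cycle_hole_at 1 C hc.
have sadj : line_graph G (e 0) s := off_adjl so vs.
have sD : s \in D := critical_dom (cycle_edgeW 0 C) sadj.
have [|t [et tD ct]] := hole_sees hc1 (i := x).
  by rewrite -csx -c1E //; apply: (hole_palette hc1).
have [to|] := classic (off_cycle e t).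
  have [_ [u]] := line_graphP et.
  rewrite (cycle_ends _ C) !inE => /orP[]/eqP-> ut.
    by case: gap; exists t; split=> //; rewrite -c1E.
  by exists t; split=> //; rewrite -c1E.
case/not_off_cycle=> i ti; subst t; have [n2 _ _ _ _] := C; have [_ en _ _] := cycle_close C.
case: (cycle_neighbour C et) => ei; rewrite ei in ct tD.
  case: (hole_proper hc1 tD _ sD (so _) sadj); last by rewrite ct c1E.
  by apply: (cycle_edge_neq C); lia.
(* Pushing the hole once around from [e 1] to [e 0] brings the colour [x] of
   [e 2] to [e 1], next to [s]. *)
have [|c' [hc' cm cE]] := cycle_shift_hole (m := n.-1) (cycle_shift 1 C) hc1; first by lia.
rewrite add1n prednK in hc'; last by lia.
rewrite en in hc'; case: (so 1); apply: (hole_inj hc' sadj (cycle_adj 0 C)).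
by rewrite cE // c1E // (cm 0) ?addn0 ?ct //; lia.
Qed.

End NoParallel.

(** * Alternation of colours around the cycle *)

Section Alternation.
Variables (n : nat) (v : nat -> V) (e : nat -> E) (c : E -> nat).
Hypothesis C : critical_cycle n v e.
Hypothesis simple : forall i g, ends G g = ends G (e i) -> g = e i.
Hypothesis hc : hole (e 0) c.

(** Moving the hole to [e i] changes no colour off the cycle, so the facts about a hole at index 0
    carry over to every index. *)
Lemma off_colour_next x i : off_colour v e c x i ->
  off_colour v e c x i.+2 /\ ~ off_colour v e c x i.+1.
Proof.
case=> s [so vs cs]; have [c' hc' cE] := cycle_hole_at i C hc.
have conv j : off_colour v e c x j <-> off_colour v e c' x j.
  by split=> -[t [to vt <-]]; exists t; split; rewrite ?cE.
have Oi : off_colour v e c' x i by apply/conv; exists s.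
split; last by move/conv; apply: (off_colour_gap C simple hc' Oi).
have hc1 : hole (e (i + 0)) c' by rewrite addn0.
have [|t [to vt ct]] :=
  off_colour_step (cycle_shift i C) (fun j => simple (i := i + j)) hc1 (x := x).
  by exists s; rewrite addn0 cE //; split=> // j; apply: so.
apply/conv; exists t; rewrite -addn2; split=> // j.
have [j' [ij _ _ <-]] := cycle_window i j C.
by have := to (j' - i); rewrite subnKC.
Qed.

Lemma off_colour_even x i q : off_colour v e c x i -> off_colour v e c x (i + q.*2).
Proof.
move=> Oi; elim: q => [|q IHq]; first by rewrite addn0.
by rewrite doubleS !addnS; apply: (off_colour_next IHq).1.
Qed.

Lemma off_colour_mul x i q : off_colour v e c x (i + q * n) <-> off_colour v e c x i.
Proof. by rewrite /off_colour; have [-> _] := cycle_add_mul i q C. Qed.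

(** For even [n], the colour of [e 1] would occur on every second edge of the cycle, so that the
    hole [e 0] would see it on both [e 1] and [e n.-1]. *)
Lemma cycle_odd : odd n.
Proof.
apply: contraT => evn; have [n2 _ _ _ _] := C; have [_ en _ adj] := cycle_close C.
have eD i : e i \in D by have /setDP[] := cycle_edgeW i C.
have ne j : 0 < j -> j < n -> e j <> e 0.
  by move=> ? ?; apply/nesym/(cycle_edge_neq C).
pose x := c (e 1).
have x0 : ~ off_colour v e c x 0.
  move=> [s [so vs]] /(hole_inj hc (off_adjl C so vs) (cycle_adj 0 C)).
  exact: so.
have x1 : ~ off_colour v e c x 1.
  move=> [s [so vs]] /(hole_inj hc (off_adjr C so vs) (cycle_adj 0 C)).
  exact: so.
(* As [n] is even, steps of two lead from [i] to an index congruent to 0 or 1 modulo [n], where [x]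
   does not occur off the cycle. *)
have xi i : ~ off_colour v e c x i.
  have [iodd|ieven] := boolP (odd i).
    have Ei : i + (i * n + 1 - i)./2.*2 = 1 + i * n.
      have : ~~ odd (i * n + 1 - i) by rewrite oddB ?oddD ?oddM ?iodd ?(negPf evn) //; nia.
      by move/even_halfK->; nia.
    by move/(off_colour_even (i * n + 1 - i)./2); rewrite Ei => /off_colour_mul.
  have Ei : i + (i * n - i)./2.*2 = 0 + i * n.
    have : ~~ odd (i * n - i) by rewrite oddB ?oddM ?(negPf ieven) //; nia.
    by move/even_halfK->; nia.
  by move/(off_colour_even (i * n - i)./2); rewrite Ei => /off_colour_mul.
(* With the hole pushed to [e q.*2.+2], the edge behind it carries the old colour of [e q.*2.+2],
   which is not [x]; so [x] must be on the edge ahead. *)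
have alt q : q.*2.+1 < n -> c (e q.*2.+1) = x.
  elim: q => [//|q IHq] ltn; rewrite doubleS in ltn *.
  have {}IHq : c (e q.*2.+1) = x by apply: IHq; lia.
  have [|c' [hc' cm cE]] := cycle_shift_hole (m := q.*2.+2) C hc; first by lia.
  have [|t [et tD ct]] := hole_sees hc' (i := x).
    by apply: (hole_palette hc) => //; apply: ne; lia.
  have [to|nto] := classic (off_cycle e t).
    have [_ [u]] := line_graphP et.
    rewrite cE // in ct.
    rewrite (cycle_ends _ C) !inE => /orP[]/eqP-> ut.
      by case: (xi q.*2.+2); exists t.
    by case: (xi q.*2.+3); exists t.
  have [i ti] := not_off_cycle nto; subst t; case: (cycle_neighbour C et) => ei; rewrite ei in ct.
    rewrite cm // in ct; case: (hole_proper hc (eD q.*2.+1) _ (eD q.*2.+2) _ (cycle_adj _ C)).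
    - by apply: ne; lia.
    - by apply: ne; lia.
    - by rewrite ct.
  rewrite cE // in ct => j jq; apply/nesym/(cycle_edge_neq C); lia.
have En : (n.-2./2).*2.+1 = n.-1 by rewrite even_halfK; lia.
have := alt n.-2./2; rewrite En => /(_ _)/(hole_inj hc (line_graph_sym adj) (cycle_adj 0 C)) e1.
by case: (cycle_edge_neq C (i := 1) (j := n.-1)); [lia | lia | rewrite e1 //; lia].
Qed.

(** As [n] is odd, [n.-1] is even, so the colour of [s] also occurs off the cycle at the vertex
    preceding [v i], and then it cannot occur at [v i]. *)
Lemma cycle_no_exit s i : v i \in ends G s -> ~ off_cycle e s.
Proof.
move=> vs so; have [n2 _ _ _ _] := C.
have Oi : off_colour v e c (c s) i by exists s.
have := off_colour_even n.-1./2 Oi.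
rewrite even_halfK; last by have := cycle_odd; lia.
move/off_colour_next => [_]; apply.
have -> : (i + n.-1).+1 = i + 1 * n by lia.
exact/off_colour_mul.
Qed.

End Alternation.

(** * The exceptional multigraphs *)

Section Exceptions.
Variable k : nat.
Hypothesis Gconn : connected G.
Hypothesis KE : K = max_degree G + k.
Hypothesis S_degree : forall u, #|S :&: incident G u| <= k.

(** Tightness and [degree G w <= max_degree G] make the degree of [u] exceed [k] plus the
    multiplicity. All edges at [u] lie in [D], and at most [k] of them in [S]. *)
Lemma critical_degree e u w : e \in W -> u <> w -> ends G e = [set u; w] ->
  multiplicity G u w < #|W :&: incident G u|.
Proof.
move=> eW nuw Ee; have := card_line_neighbours nuw Ee.
rewrite (critical_card eW) KE.
have dw : degree G w <= max_degree G by apply: leq_bigmax.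
suff : degree G u <= #|S :&: incident G u| + #|W :&: incident G u|.
  by have := S_degree u; lia.
apply: leq_trans (leq_card_setU _ _); apply/subset_leq_card/subsetP => g.
rewrite !inE => ug; rewrite ug !andbT; case: (boolP (g \in S)) => //= gS.
have [->|/eqP nge] := eqVneq g e; first by have /setDP[] := eW.
apply: (critical_dom eW); apply: line_graphI _ ug _; first by rewrite Ee !inE eqxx.
by move/esym.
Qed.

Lemma critical_branch e u w : e \in W -> u <> w -> ends G e = [set u; w] ->
  exists2 f, f \in W & exists2 x, ends G f = [set u; x] & x <> w.
Proof.
move=> eW nuw Ee; apply: NNPP => no.
have := critical_degree eW nuw Ee; rewrite ltnNge => /negP; apply.
apply/subset_leq_card/subsetP => f /setIP[fW]; rewrite !inE => uf.
have [x _ Ef] := ends_pair uf; apply/eqP; rewrite Ef; congr [set u; _].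
by apply: NNPP => nxw; apply: no; exists f => //; exists x.
Qed.

(** * Existence of a cycle in [W] *)

Definition critical_adj : rel V := [rel u w | [exists f in W, ends G f == [set u; w]]].

Lemma critical_adjP u w :
  reflect (exists2 f, f \in W & ends G f = [set u; w]) (critical_adj u w).
Proof. by apply: (iffP exists_inP) => -[f fW /eqP Ef]; exists f => //; apply/eqP. Qed.


Lemma critical_adj_sym u w : critical_adj u w -> critical_adj w u.
Proof. by case/critical_adjP=> f fW Ef; apply/critical_adjP; exists f; rewrite 1?setUC. Qed.

Lemma critical_adj_neq u w : critical_adj u w -> u <> w.
Proof. by case/critical_adjP=> f _ Ef uw; have := card_ends G f; rewrite Ef uw cards2 eqxx. Qed.

(* The start of a longest path has a second neighbour, which lies on the path. *)
Lemma ex_vertex_cycle x y q :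
  path critical_adj x (y :: q) -> uniq [:: x, y & q] ->
  exists z p, [/\ 1 < size p, uniq (z :: p), path critical_adj z p &
                  critical_adj (last z p) z].
Proof.
have [m] := ubnP (#|V| - size q); elim: m => // m IHm in x y q *; rewrite ltnS => le_m.
move=> pth unq; have xy : critical_adj x y by case/andP: pth.
have sz : (size q).+2 <= #|V| by rewrite -[_.+2]/(size [:: x, y & q]) -(card_uniqP unq) max_card.
have /critical_adjP[f fW Ef] := xy.
have [g gW [z Eg nzy]] := critical_branch fW (critical_adj_neq xy) Ef.
have xz : critical_adj x z by apply/critical_adjP; exists g.
have [zq|nzq] := boolP (z \in [:: x, y & q]); last first.
  apply: (IHm z x (y :: q)).
  - by apply: leq_trans le_m; apply: ltn_sub2l => //=; apply: leq_trans sz.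
  - by rewrite /= critical_adj_sym.
  - by rewrite cons_uniq nzq.
have {}zq : z \in q.
  move: zq; rewrite !inE => /or3P[/eqP zx|/eqP//|//].
  by case: (critical_adj_neq xz).
case/splitPr: zq => q1 q2 in pth unq.
exists x, (y :: rcons q1 z); split.
- by rewrite /= size_rcons.
- by move: unq; rewrite -cat_rcons -!cat_cons cat_uniq => /andP[].
- by move: pth; rewrite -cat_rcons -cat_cons cat_path => /andP[].
- by rewrite /= last_rcons critical_adj_sym.
Qed.

Lemma ex_critical_cycle h : h \in W -> exists n v e, critical_cycle n v e.
Proof.
move=> hW; have /eqP/cards2P[x [y [nxy Eh]]] := card_ends G h.
have [||z [p [sp unq pth lst]]] := @ex_vertex_cycle x y [::].
- by rewrite /= andbT; apply/critical_adjP; exists h.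
- by rewrite /= inE nxy.
pose n := (size p).+1; pose v i := nth z (z :: p) (i %% n).
(* The default [h] is a filler: consecutive vertices are always joined by an edge of [W]. The choice
   depends only on the two vertices, so [e] inherits the period of [v]. *)
pose e i := odflt h [pick f in W | ends G f == [set v i; v i.+1]].
have vn i : v (i + n) = v i by rewrite /v modnDr.
exists n, v, e; split=> //.
- by move=> i; rewrite /e -addSn !vn.
- move=> i j ij jn /eqP; rewrite /v nth_uniq ?ltn_pmod // => /eqP ijn.
  have : n %| j - i by rewrite -eqn_mod_dvd ?ijn // ltnW.
  by rewrite gtnNdvd //; lia.
move=> i; suff /critical_adjP[f fW Ef] : critical_adj (v i) (v i.+1).
  rewrite /e; case: pickP => [g /andP[gW /eqP]//|/(_ f)].
  by rewrite /= fW Ef eqxx.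
have ltr : i %% n < n by rewrite ltn_pmod.
rewrite /v -[i.+1]addn1 -modnDml addn1.
have [lt|nlt] := boolP ((i %% n).+1 < n).
  by rewrite [_.+1 %% n]modn_small //; apply: (pathP z pth).
have -> : (i %% n).+1 = n by lia.
have -> : i %% n = size p by lia.
by rewrite modnn nth_last.
Qed.

(** * Determination of the multigraph from its cycle *)

Lemma connected_closed (X : {set V}) u :
  u \in X -> (forall e x y, ends G e = [set x; y] -> x \in X -> y \in X) ->
  X = [set: V].
Proof.
move=> uX clo; apply/setP=> w; rewrite inE.
have [_ /(_ u w)/connectP[p pth ->]] := Gconn.
elim: p => //= x p IHp in u uX pth *; case/andP: pth => ux /IHp; apply.
by move: ux => /card_gt0P[e]; rewrite inE => /eqP /clo; apply.
Qed.

(** Only [e i] and its predecessor, written [e (i + n.-1)] to avoid subtracting from [i], are edges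
    of [W] at [v i]; [critical_degree] puts the multiplicity below two. *)
Lemma cycle_simple n v e : critical_cycle n v e -> 3 < n ->
  forall i g, ends G g = ends G (e i) -> g = e i.
Proof.
move=> C n3 i g Eg; have [n2 _ _ vI _] := C.
have nv : v i <> v i.+1 by apply: vI; lia.
have := critical_degree (cycle_edgeW i C) nv (cycle_ends i C).
have : #|W :&: incident G (v i)| <= 2.
  apply: leq_trans (_ : #|[set e i; e (i + n.-1)]| <= 2); last by rewrite cards2; lia.
  apply/subset_leq_card/subsetP => f /setIP[fW]; rewrite !inE => vf.
  have := cycle_critical_edges (cycle_shift i C) n3 fW.
  by rewrite addn0 => /(_ vf)[]->; rewrite eqxx ?orbT.
move=> le2 lt; have /card_le1_eqP : multiplicity G (v i) (v i.+1) <= 1 by lia.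
by apply; rewrite inE ?Eg (cycle_ends i C).
Qed.

Lemma critical_long_cycle n v e : critical_cycle n v e -> 3 < n ->
  k = 0 /\ simple_odd_cycle G.
Proof.
move=> C n3; have [n2 vn en vI _] := C; have [vn0 en0 Een adj] := cycle_close C.
have simple := cycle_simple C n3.
have [c hc] := ex_hole (cycle_edgeW 0 C).
(* No edge leaves the cycle, so its vertex set is closed under adjacency and connectedness makes it
   everything. *)
have VX : [set v i | i : 'I_n] = [set: V].
  have vX i : v i \in [set v i | i : 'I_n].
    have [j [_ jn <- _]] := cycle_window 0 i C.
    by apply/imsetP; exists (Ordinal jn).
  apply: (connected_closed (vX 0)) => s x y Es /imsetP[i _ xi].
  have vs : v i \in ends G s by rewrite Es xi !inE eqxx.
  have [j sj] := not_off_cycle (cycle_no_exit C simple hc vs).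
  have : y \in ends G s by rewrite Es !inE eqxx orbT.
  by rewrite sj (cycle_ends j C) !inE => /orP[]/eqP->.
have eE s : exists i, s = e i.
  have /card_gt0P[x xs] : 0 < #|ends G s| by rewrite card_ends.
  have : x \in [set v i | i : 'I_n] by rewrite VX.
  by case/imsetP=> i _ xi; subst x; apply/not_off_cycle/(cycle_no_exit C simple hc xs).
have EX : [set e i | i : 'I_n] = [set: E].
  apply/setP=> s; rewrite inE; have [i ->] := eE s.
  have [j [_ jn _ <-]] := cycle_window 0 i C.
  by apply/imsetP; exists (Ordinal jn).
split.
  (* Every edge is on the cycle, so [e 0] has at most two neighbours. As [v 0] has degree at least
     two, [K = max_degree G + k] leaves only [k = 0]. *)
  have leK : K <= 2.
    rewrite -(critical_card (cycle_edgeW 0 C)).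
    apply: leq_trans (_ : #|[set e 1; e n.-1]| <= 2); last by rewrite cards2; lia.
    apply/subset_leq_card/subsetP => s; rewrite !inE => es.
    have [j sj] := eE s; subst s; move: es; rewrite -en0.
    have Sn : n = n.-1.+1 by lia.
    rewrite [in e n]Sn => /(cycle_neighbour C)[]->; first by rewrite eqxx orbT.
    by rewrite -Sn -[n.+1]add1n en eqxx.
  suff : 2 <= max_degree G by lia.
  apply: leq_trans (leq_bigmax (F := degree G) (v 0)).
  have <- : #|[set e 0; e n.-1]| = 2.
    rewrite cards2; case: eqP => // /(cycle_edge_neq C); case; lia.
  apply/subset_leq_card/subsetP => s; rewrite !inE => /orP[]/eqP->.
    exact: cycle_meml C.
  by rewrite Een !inE eqxx orbT.
exists n; split; [exact: (cycle_odd C simple hc) | lia |].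
have inj (T : Type) (f : nat -> T) : (forall i j, i < j -> j < i + n -> f i <> f j) ->
    injective (fun i : 'I_n => f i).
  move=> fI i j fij; apply: val_inj => /=; have := ltn_ord i; have := ltn_ord j.
  have [lt|lt|//] := ltngtP i j => ? ?; [case: (fI i j) | case: (fI j i)] => //; lia.
exists (fun i => v i), (fun i => e i); split.
- apply: inj_card_bij; first by apply: inj.
  by rewrite -cardsT -VX leq_imset_card.
- apply: inj_card_bij; first by apply: inj => i j; apply: cycle_edge_neq C.
  by rewrite -cardsT -EX leq_imset_card.
- move=> i; rewrite (cycle_ends _ C); congr [set _; _] => /=.
  have [lt|nlt] := boolP (i.+1 < n); first by rewrite modn_small.
  have -> : i.+1 = n by have := ltn_ord i; lia.
  by rewrite modnn.
Qed.

Lemma multiplicity_sym u w : multiplicity G u w = multiplicity G w u.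
Proof. by rewrite /multiplicity setUC. Qed.

Lemma degree_three_vertices x y z : x <> y -> y <> z -> x <> z ->
  [set: V] = [set x; y; z] ->
  degree G x = multiplicity G x y + multiplicity G x z.
Proof.
move=> nxy nyz nxz VE; rewrite /multiplicity -cardsUI.
have -> : [set f | ends G f == [set x; y]] :&: [set f | ends G f == [set x; z]] = set0.
  apply/setP=> f; rewrite !inE; apply/negP => /andP[/eqP-> /eqP/setP/(_ y)].
  by rewrite !inE eqxx orbT => /esym/orP[]/eqP // /esym.
rewrite cards0 addn0; apply: eq_card => f; rewrite !inE.
apply/idP/orP => [xf|[]/eqP->]; try by rewrite !inE eqxx.
have [w nxw ->] := ends_pair xf.
have : w \in [set: V] by []; rewrite VE !inE => /orP[/orP[]|] /eqP wE.
- by case: nxw.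
- by left; rewrite wE.
- by right; rewrite wE.
Qed.

Lemma critical_triangle v e : critical_cycle 3 v e ->
  exists m1 m2 m3, fat_triangle G m1 m2 m3 /\ k = minn m1 (minn m2 m3) - 1.
Proof.
move=> C; have [_ vn _ vI _] := C.
have exit (i : nat) s : v i \in ends G s -> v i.+1 \in ends G s \/ v i.+2 \in ends G s.
  move=> vs; apply: NNPP => no.
  apply: (@triangle_no_exit (v i) (v i.+1) (v i.+2) (e i) (e i.+1) (e i.+2) s) => //;
    try exact: cycle_edgeW C; rewrite ?(cycle_ends _ C) //.
  - by rewrite -[in v i.+3]addn3 vn setUC.
  - by apply/negP => ?; apply: no; left.
  - by apply/negP => ?; apply: no; right.
have [n01 n12 n02] : [/\ v 0 <> v 1, v 1 <> v 2 & v 0 <> v 2] by split; apply: vI.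
have VE : [set: V] = [set v 0; v 1; v 2].
  have vX i : v i \in [set v 0; v 1; v 2].
    have [[|[|[|j]]] [_ // _ <- _]] := cycle_window 0 i C; by rewrite !inE eqxx ?orbT.
  apply/esym; apply: (connected_closed (vX 0)) => s x y Es.
  have nxy : x <> y by move=> xy; have := card_ends G s; rewrite Es xy cards2 eqxx.
  have xv i : x = v i -> y \in [set v 0; v 1; v 2].
    move=> xi; have vs : v i \in ends G s by rewrite Es xi !inE eqxx.
    have step j : v i <> v j -> v j \in ends G s -> y \in [set v 0; v 1; v 2].
      move=> nij; rewrite Es !inE xi => /orP[]/eqP vj; first by case: nij.
      by have := vX j; rewrite vj !inE.
    by case: (exit i s vs); apply: step; apply: vI; lia.
  move=> xX; have [i xi] : exists i, x = v i; last exact: xv xi.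
  by move: xX; rewrite !inE => /orP[/orP[]|] /eqP->; [exists 0 | exists 1 | exists 2].
have d0 := degree_three_vertices n01 n12 n02 VE.
have d1 : degree G (v 1) = multiplicity G (v 1) (v 0) + multiplicity G (v 1) (v 2).
  by apply: degree_three_vertices => //; [exact/nesym | rewrite VE (setUC [set v 0])].
have d2 : degree G (v 2) = multiplicity G (v 2) (v 0) + multiplicity G (v 2) (v 1).
  apply: degree_three_vertices; [exact/nesym | by [] | exact/nesym |].
  by rewrite VE setUC setUA.
rewrite (multiplicity_sym (v 1) (v 0)) in d1.
rewrite (multiplicity_sym (v 2) (v 0)) (multiplicity_sym (v 2) (v 1)) in d2.
have := card_line_neighbours n01 (cycle_ends 0 C).
rewrite (critical_card (cycle_edgeW 0 C)) => cardK.
have le i : degree G (v i) <= max_degree G by apply: leq_bigmax.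
have ge : max_degree G <= maxn (degree G (v 0)) (maxn (degree G (v 1)) (degree G (v 2))).
  apply/bigmax_leqP => u _; have : u \in [set: V] by [].
  by rewrite VE !inE => /orP[/orP[]|] /eqP->; lia.
exists (multiplicity G (v 0) (v 1)), (multiplicity G (v 1) (v 2)), (multiplicity G (v 0) (v 2)).
have pos i : 0 < multiplicity G (v i) (v i.+1).
  by apply/card_gt0P; exists (e i); rewrite inE (cycle_ends i C).
have pos2 : 0 < multiplicity G (v 0) (v 2).
  by rewrite multiplicity_sym -[v 0]vn; apply: pos.
(* Let [m] be the sum of the three multiplicities. Tightness of [e 0] gives [K = m - 1], and the
   maximum degree is [m] minus the smallest multiplicity, since each vertex misses just the opposite
   side. *)
split; last by have := (le 0, le 1, le 2) => -[[]]; lia.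
exists (v 0), (v 1), (v 2); split=> //.
rewrite /= !inE !andbT; apply/andP; split; last exact/eqP.
by apply/norP; split; apply/eqP.
Qed.

Lemma critical_exceptions h : h \in W ->
  (k = 0 /\ simple_odd_cycle G) \/
  (exists m1 m2 m3, fat_triangle G m1 m2 m3 /\ k = minn m1 (minn m2 m3) - 1).
Proof.
case/ex_critical_cycle=> n [v [e C]]; have [n2 _ _ _ _] := C.
have [n3|n3] := boolP (3 < n); first by left; apply: critical_long_cycle C n3.
right; have n_3 : n = 3 by lia.
by subst n; apply: critical_triangle C.
Qed.

End Exceptions.

End Critical.

(** * Minimal non-extendable sets and the extension theorem *)

(** Edges outside [S] are deleted from [X] as long as the remaining set is not extendable. *)
Lemma ex_critical_set (V E : finType) (G : multigraph V E) K (S X : {set E}) c :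
  S \subset X -> ~ extendable G K S c X ->
  exists D : {set E}, [/\ S \subset D, ~ extendable G K S c D &
    forall e, e \in D :\: S -> extendable G K S c (D :\ e)].
Proof.
have [m] := ubnP #|X|; elim: m => // m IHm in X *; rewrite ltnS => leX SX nX.
have [crit|] := classic (forall e, e \in X :\: S -> extendable G K S c (X :\ e)).
  by exists X.
move=> nc; have [e eX ne] : exists2 e, e \in X :\: S & ~ extendable G K S c (X :\ e).
  by apply: NNPP => no; apply: nc => e eX; apply: NNPP => ne; apply: no; exists e.
have /setDP[eD eS] := eX.
apply: (IHm (X :\ e)) => //; first by rewrite (cardsD1 e X) eD in leX.
by apply/subsetP => f fS; rewrite !inE (subsetP SX) // andbT; apply: contraNneq eS => <-.
Qed.

Theorem theorem1p8 (V E : finType) (G : multigraph V E) (k : nat)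
    (S : {set E}) (c : E -> nat)
    (Gconn : connected G)
    (hL : max_degree_rel (line_graph G) <= max_degree G + k)
    (hc : proper_edge_colouring G (palette (max_degree G + k)) S c)
    (hS : forall v : V, #|S :&: incident G v| <= k)
    (hcycle : ~ (k = 0 /\ simple_odd_cycle G))
    (htriangle : ~ (exists m1 m2 m3 : nat,
       fat_triangle G m1 m2 m3 /\ k = minn m1 (minn m2 m3) - 1)) :
  exists c' : E -> nat,
    proper_edge_colouring G (palette (max_degree G + k)) [set: E] c' /\
    extends S c c'.
Proof.
apply: NNPP => nT.
have [D [SD nD crit]] := ex_critical_set (subsetT S) nT.
have dL e : #|[set f | line_graph G e f]| <= max_degree G + k.
  apply: leq_trans hL.
  exact: (leq_bigmax (F := fun x => #|[set y | line_graph G x y]|)).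
(* If [D] were just [S], the precolouring [c] itself would be an extension to [D]. *)
have [DS|[h hW]] := set_0Vmem (D :\: S).
  apply: nD; have -> : D = S by apply/eqP; rewrite eqEsubset SD andbT -setD_eq0 DS.
  by exists c; split=> // e.
by case: (critical_exceptions dL SD nD crit Gconn erefl hS hW).
Qed.
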